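(* Let $r,n,d\in\mathbb{Z}_{>0}$ and $l\in\mathbb{Z}$ with $0<r<n$. Let $[n]=\{1,\dots,n\}$, let $I\subsetneq[n]$ be a subset with $r$ elements, and let $I^\complement=[n]\setminus I$. For variables $x_1,\dots,x_n$ (and $q$) and any subset $J$ of $[n]$ with $\emptyset\ne J\subsetneq [n]$, $J^\complement=[n]\setminus J$, and any integer $m$, define the rational functions $$A_d(\vec x,J,m)=\sum_{|\vec d_J|=d}\frac{\left(\prod_{i\in J}x_i^{d_i}q^{\frac{d_i(d_i-1)}{2}}\right)^m}{\prod_{i,j\in J}\left(q^{d_{ij}+1}x_{ij};q\right)_{d_j}\ \prod_{i\in J}\prod_{j\in J^\complement}(qx_{ij};q)_{d_i}},$$ $$B_d(\vec x,J,m)=\sum_{|\vec d_J|=d}\frac{\left(\prod_{i\in J}x_i^{-d_i}q^{\frac{d_i(d_i+1)}{2}}\right)^m}{\prod_{i,j\in J}\left(q^{d_{ij}+1}x_{ji};q\right)_{d_j}\ \prod_{i\in J}\prod_{j\in J^\complement}(qx_{ji};q)_{d_i}}.$$ If $1-|I|\le l\le n-|I|-1$, then $$A_d(\vec x,I,l)=B_d(\vec x,I^\complement,-l).$$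
   Context: Notation: $\vec d_J=(d_i)_{i\in J}$ is a $|J|$-tuple of non-negative integers, $|\vec d_J|=\sum_{i\in J}d_i$, $x_{ij}=x_i/x_j$, $d_{ij}=d_i-d_j$. The products over $i,j\in J$ run over all ordered pairs, including $i=j$. The $q$-Pochhammer symbol is $(a;q)_0=1$ and $(a;q)_d=(1-a)(1-qa)\cdots(1-q^{d-1}a)$ for $d>0$. The identity is one of rational functions in $x_1,\dots,x_n$ and $q$. *)

(* Defs.v *)
From HB Require Import structures.
From mathcomp Require Import all_boot all_order all_algebra.
From mathcomp Require Import mpoly.

Set Implicit Arguments.
Unset Strict Implicit.
Unset Printing Implicit Defensive.

Import GRing.Theory.
Local Open Scope ring_scope.

Definition qpoch (K : fieldType) (a q : K) (d : nat) : K :=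
  \prod_(k < d) (1 - q ^+ k * a).

(* The tuples of non-negative integers indexed by J with sum d, encoded as
   functions on the whole of 'I_n vanishing off J; the bound d on the values is
   no restriction, since each entry of such a tuple is at most d. *)
Definition tuples_of_sum (n d : nat) (J : {set 'I_n}) :
    {set {ffun 'I_n -> 'I_d.+1}} :=
  [set e : {ffun 'I_n -> 'I_d.+1} | [forall i, (i \notin J) ==> (e i == ord0)]
           && (\sum_(i in J) e i == d)%N].

Definition A_sum (K : fieldType) (n d : nat) (x : 'I_n -> K) (q : K)
    (J : {set 'I_n}) (m : int) : K :=
  \sum_(e in tuples_of_sum d J)
     (\prod_(i in J) (x i ^+ e i * q ^+ (e i * (e i).-1)./2)) ^ m
     / ((\prod_(i in J) \prod_(j in J)
           qpoch (q ^ ((e i)%:Z - (e j)%:Z + 1) * (x i / x j)) q (e j))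
        * \prod_(i in J) \prod_(j in ~: J) qpoch (q * (x i / x j)) q (e i)).

Definition B_sum (K : fieldType) (n d : nat) (x : 'I_n -> K) (q : K)
    (J : {set 'I_n}) (m : int) : K :=
  \sum_(e in tuples_of_sum d J)
     (\prod_(i in J) (x i ^- e i * q ^+ (e i * (e i).+1)./2)) ^ m
     / ((\prod_(i in J) \prod_(j in J)
           qpoch (q ^ ((e i)%:Z - (e j)%:Z + 1) * (x j / x i)) q (e j))
        * \prod_(i in J) \prod_(j in ~: J) qpoch (q * (x j / x i)) q (e i)).

(* The field F(q, x_1, ..., x_n): among the n + 1 indeterminates, the one of
   index ord0 is q, and the others are the x_i. *)
Definition ratfun (F : fieldType) (n : nat) : fieldType :=
  {fraction {mpoly F[n.+1]}}.

Definition qvar (F : fieldType) (n : nat) : ratfun F n :=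
  tofrac ('X_ord0 : {mpoly F[n.+1]}).

Definition xvar (F : fieldType) (n : nat) (i : 'I_n) : ratfun F n :=
  tofrac ('X_(lift ord0 i) : {mpoly F[n.+1]}).

(* Main.v *)
(* Both sums satisfy a first-order recursion in d. If S_i multiplies x_i by q
   and E f = sum_(i in I) a_i(x) (f o S_i), where a_i is 1 - q times the i-th
   term of A_1, then (1 - q^(d+1)) A_(d+1) = E A_d; likewise
   (1 - q^(d+1)) B_(d+1) = F B_d for an operator F built from the inverse shifts
   S_j^-1, j outside I. The operators E and F commute, and E 1 = F 1 is the
   vanishing of sum_k y_k^(l+|I|-1) / prod_(j <> k) (y_k - y_j) at the n nodes
   x_i (i in I), x_j / q (j outside I), which is where the bounds on l enter.
   Hence E^d 1 = F^d 1. *)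
Require Import Defs.
From mathcomp Require Import all_boot all_order all_algebra.
From mathcomp Require Import mpoly ring.

Set Implicit Arguments.
Unset Strict Implicit.
Unset Printing Implicit Defensive.

Import GRing.Theory Num.Theory.
Local Open Scope ring_scope.

(** * Interpolation identities *)

Section Lagrange.

Variable K : fieldType.

(** The polynomial [p] equals its Lagrange interpolant at the nodes [s]. Each basis polynomial [W a]
    is monic of size [size s], so the sum collects the coefficients of the [W a] in top degree. *)
Lemma lagrange_sum_lead (s : seq K) (p : {poly K}) :
  uniq s -> (size p <= size s)%N ->
  \sum_(a <- s) p.[a] / \prod_(b <- s | b != a) (a - b) = p`_(size s).-1.
Proof.
case: s => [|a0 s0]; first by rewrite big_nil leqn0 size_poly_eq0 => _ /eqP->;
  rewrite coef0.
set s := a0 :: s0 => us sp.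
pose W a := \prod_(b <- s | b != a) ('X - b%:P).
have szW a : a \in s -> size (W a) = size s.
  move=> sa; rewrite /W -big_filter size_prod_XsubC -rem_filter //.
  by rewrite size_rem.
have monW a : W a \is monic.
  by rewrite /W -big_filter monic_prod_XsubC.
have W0 a b : a \in s -> a != b -> (W b).[a] = 0.
  move=> sa ab; apply/eqP; rewrite /W horner_prod prodf_seq_eq0.
  by apply/hasP; exists a; rewrite // ab hornerXsubC subrr eqxx.
have Wa a : (W a).[a] = \prod_(b <- s | b != a) (a - b).
  by rewrite /W horner_prod; apply: eq_bigr => b _; rewrite hornerXsubC.
have Wn0 a : (W a).[a] != 0.
  by rewrite Wa prodf_seq_neq0; apply/allP => b _; rewrite subr_eq0 eq_sym;
    apply/implyP.
pose L := \sum_(a <- s) (p.[a] / (W a).[a]) *: W a.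
(* The difference has size at most [size s] and vanishes at all the distinct nodes. *)
have -> : p = L.
  apply/eqP; rewrite -subr_eq0; apply/eqP.
  apply: (@roots_geq_poly_eq0 _ _ s) => //; last first.
    apply: leq_trans (size_polyD _ _) _; rewrite size_polyN geq_max sp /=.
    apply: leq_trans (size_sum _ _ _) _.
    apply/bigmax_leqP_seq => a sa _; apply: leq_trans (size_scale_leq _ _) _.
    by rewrite szW.
  apply/allP => a sa; rewrite /root hornerD hornerN /L horner_sum.
  rewrite (bigD1_seq a) //= hornerZ divfK // big1_seq ?addr0 ?subrr //.
  by move=> b /andP[ba sb]; rewrite hornerZ (W0 a b) ?mulr0 // eq_sym.
rewrite [in RHS]/L coef_sum [in RHS]big_seq [in LHS]big_seq.
apply: eq_bigr => a sa.
rewrite coefZ -(szW a sa) -/(lead_coef _) (monicP (monW a)) mulr1 -Wa.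
congr (_ / _); rewrite /L horner_sum (bigD1_seq a) //= hornerZ divfK //.
rewrite big1_seq ?addr0 // => b /andP[ba sb].
by rewrite hornerZ (W0 a b) ?mulr0 // eq_sym.
Qed.

(* Interpolates prod_k (X - c_k x_k) at the x_k and at the extra node 0. *)
Lemma lagrange_sum_ratio (T : finType) (J : {set T}) (x c : T -> K) :
  {in J &, injective x} -> (forall k, x k != 0) ->
  \sum_(i in J) (\prod_(k in J) (1 - c k * x k / x i))
                / \prod_(k in J | k != i) (1 - x k / x i)
  = 1 - \prod_(k in J) c k.
Proof.
move=> x_inj x_neq0.
pose s := 0 :: [seq x k | k <- enum J].
pose p := \prod_(k <- enum J) ('X - (c k * x k)%:P).
have us : uniq s.
  rewrite /= map_inj_in_uniq ?enum_uniq ?andbT.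
    by apply/mapP => -[k _ /eqP]; rewrite eq_sym (negPf (x_neq0 k)).
  by move=> i j; rewrite !mem_enum; apply: x_inj.
have szp : size p = size s by rewrite size_prod_XsubC /= size_map.
have := lagrange_sum_lead us (eq_leq szp).
rewrite -szp -/(lead_coef p) (monicP (monic_prod_XsubC _ _ _)).
move=> lead1; rewrite -[X in X - _]lead1.
rewrite big_cons big_cons eqxx /= big_map big_enum_cond /=.
rewrite big_map big_enum /=.
have pE a : p.[a] = \prod_(k in J) (a - c k * x k).
  by rewrite horner_prod big_enum /=; apply: eq_bigr => k _; exact: hornerXsubC.
have -> : p.[0] / \prod_(k in J | x k != 0) (0 - x k) = \prod_(k in J) c k.
  rewrite pE [X in _ / X](eq_bigl (mem J)) /=; last first.
    by move=> k; rewrite x_neq0 andbT.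
  rewrite -prodf_div; apply: eq_bigr => k _.
  by rewrite !sub0r invrN mulrNN mulfK.
rewrite addrAC subrr add0r; apply: eq_bigr => i iJ.
rewrite big_cons [0 == _]eq_sym x_neq0 big_map big_enum_cond /= subr0 pE.
have -> : \prod_(k in J) (1 - c k * x k / x i)
    = (\prod_(k in J) (x i - c k * x k)) / \prod_(k in J) x i.
  by rewrite -prodf_div; apply: eq_bigr => k _; rewrite mulrBl divff.
have -> : \prod_(k in J | k != i) (1 - x k / x i)
    = (\prod_(k in J | k != i) (x i - x k)) / \prod_(k in J | k != i) x i.
  by rewrite -prodf_div; apply: eq_bigr => k _; rewrite mulrBl divff.
have -> : \prod_(k in J | x k != x i) (x i - x k)
    = \prod_(k in J | k != i) (x i - x k).
  apply: eq_bigl => k; have [kJ|//] := boolP (k \in J).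
  by rewrite /= (inj_in_eq x_inj).
rewrite [\prod_(k in J) x i](bigD1 i) //= invf_div.
set X := \prod_(k in J | k != i) x i.
have X_neq0 : X != 0 by apply/prodf_neq0.
by rewrite !invfM -[RHS]mulr1 -(mulVf X_neq0); ring.
Qed.

End Lagrange.

Lemma expfz_prod (K : fieldType) (I : Type) (r : seq I) (P : pred I)
    (f : I -> K) (m : int) :
  (\prod_(i <- r | P i) f i) ^ m = \prod_(i <- r | P i) f i ^ m.
Proof.
by apply: (big_morph (fun z : K => z ^ m)) => [x y|]; rewrite ?expfzMl ?exp1rz.
Qed.

Lemma prod_expr_ord (K : fieldType) (q : K) (d : nat) :
  \prod_(t < d) q ^+ t = q ^+ (d * d.-1)./2.
Proof. by rewrite prodrXr -(big_mkord xpredT id) bin2_sum bin2. Qed.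

(** * The summands as products over lattice points *)

Section Recursion.

Variables (K : fieldType) (n : nat) (q : K).
Implicit Types (J : {set 'I_n}) (m : int) (x : {ffun 'I_n -> K}).

(** Separation is required for all powers of [q], which makes the condition stable under the shifts
    by [q] and [q^-1] and under inversion of the [x_i]. *)
Definition generic x :=
  (forall i, x i != 0) /\
  (forall i j a b, i != j -> q ^+ a * x i != q ^+ b * x j).

(* The summand of A_d at e is a product over the lattice points q^t x_k with
   t < e_k; the factor depends on e only through the end points q^e_i x_i, which
   stay the same when x_i is shifted and e_i is lowered by 1. *)
Definition box J m x (e : 'I_n -> nat) (b : K) : K :=
  b ^ m / ((\prod_(i in J) (1 - q ^+ e i * x i / b))
           * \prod_(j in ~: J) (1 - q * (b / x j))).

Definition box_prod J m x (e : 'I_n -> nat) : K :=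
  \prod_(k in J) \prod_(t < e k) box J m x e (q ^+ t * x k).

Lemma eq_box_prod J m x e e' :
  e =1 e' -> box_prod J m x e = box_prod J m x e'.
Proof.
move=> ee'; apply: eq_bigr => k _; rewrite ee'; apply: eq_bigr => t _.
by congr (_ / (_ * _)); apply: eq_bigr => i _; rewrite ee'.
Qed.

Hypothesis q_neq0 : q != 0.

(** Reading the factors backwards turns the exponent [c - d + 1 + (d - 1 - t)] into [c - t], which
    separates the end point [q^c] from the lattice point [q^t]. *)
Lemma qpoch_rev (a : K) (c d : nat) :
  qpoch (q ^ (c%:Z - d%:Z + 1) * a) q d
  = \prod_(t < d) (1 - q ^+ c * a / q ^+ t).
Proof.
rewrite /qpoch (reindex_inj rev_ord_inj) /=; apply: eq_bigr => t _.
have -> : q ^+ (d - t.+1) = q ^ (d%:Z - t%:Z - 1).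
  by rewrite exprnP -subzn // -addn1 PoszD opprD addrA.
rewrite mulrA -expfzDr // [in RHS]mulrAC [q ^+ c]exprnP [q ^+ t]exprnP.
rewrite invr_expz -expfzDr //; congr (1 - q ^ _ * a); ring.
Qed.

(** Each Pochhammer symbol is a product over [t < e k] for a single [k], and the triangular power of
    [q] is the product of the [q^t]; collecting the factors with the same [k] and [t] gives
    [box]. *)
Lemma summand_box_prod J m x (e : 'I_n -> nat) :
  (\prod_(i in J) (x i ^+ e i * q ^+ (e i * (e i).-1)./2)) ^ m
     / ((\prod_(i in J) \prod_(j in J)
           qpoch (q ^ ((e i)%:Z - (e j)%:Z + 1) * (x i / x j)) q (e j))
        * \prod_(i in J) \prod_(j in ~: J) qpoch (q * (x i / x j)) q (e i))
  = box_prod J m x e.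
Proof.
rewrite /box_prod /box.
under [RHS]eq_bigr => k _ do
  rewrite big_split /= prodfV -expfz_prod !big_split /=.
rewrite [RHS]big_split /= prodfV -expfz_prod [in X in _ = _ / X]big_split /=.
congr (_ ^ m / (_ * _)).
- by apply: eq_bigr => i _; rewrite prod_expr_ord mulrC prodr_const card_ord.
- rewrite exchange_big /=; apply: eq_bigr => k _.
  rewrite [RHS]exchange_big /=; apply: eq_bigr => i _.
  rewrite qpoch_rev; apply: eq_bigr => t _.
  by rewrite invfM; congr (1 - _); ring.
apply: eq_bigr => k _; rewrite [RHS]exchange_big /=; apply: eq_bigr => j _.
by apply: eq_bigr => t _; congr (1 - _); ring.
Qed.

(** * Reindexing sums over tuples *)

(** The bound [N] on the entries is independent of the sum [d], so that tuples of sums [d] and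
    [d.+1] can share a type. For [N = d] this is [tuples_of_sum]. *)
Definition bounded_tuples (N d : nat) (J : {set 'I_n}) :
    {set {ffun 'I_n -> 'I_N.+1}} :=
  [set e : {ffun 'I_n -> 'I_N.+1} | [forall i, (i \notin J) ==> (e i == ord0)]
           && (\sum_(i in J) e i == d)%N].

Lemma bounded_tuplesP N d J (e : {ffun 'I_n -> 'I_N.+1}) :
  reflect ((forall i, i \notin J -> e i = ord0) /\ (\sum_(i in J) e i = d)%N)
          (e \in bounded_tuples N d J).
Proof.
rewrite inE; apply: (iffP andP) => -[]; last first.
  by move=> h /eqP ?; split=> //; apply/forallP => i; apply/implyP => /h ->.
by move=> /forallP h /eqP ?; split=> // i iJ; apply/eqP/(implyP (h i)).
Qed.

Lemma bounded_tuples_le N d J e (i : 'I_n) :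
  e \in bounded_tuples N d J -> (e i <= d)%N.
Proof.
move=> /bounded_tuplesP[e0 <-]; have [iJ|/e0->//] := boolP (i \in J).
by rewrite (bigD1 i) //= leq_addr.
Qed.

(** [G] takes functions to [nat] so that one summand makes sense under both bounds; its
    extensionality is therefore a hypothesis. *)
Lemma sum_bounded_tuples_widen (N d : nat) J (G : ('I_n -> nat) -> K) :
  (d <= N)%N -> (forall e e', e =1 e' -> G e = G e') ->
  \sum_(e in bounded_tuples d d J) G (fun i => e i)
  = \sum_(e in bounded_tuples N d J) G (fun i => e i).
Proof.
move=> dN Gext.
pose f (e : {ffun 'I_n -> 'I_N.+1}) : {ffun 'I_n -> 'I_d.+1} :=
  [ffun i => inord (e i)].
pose g (e : {ffun 'I_n -> 'I_d.+1}) : {ffun 'I_n -> 'I_N.+1} :=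
  [ffun i => inord (e i)].
have gE e i : g e i = e i :> nat.
  by rewrite ffunE inordK // ltnS (leq_trans _ dN) // -ltnS.
have fE e i : e \in bounded_tuples N d J -> f e i = e i :> nat.
  by move=> eT; rewrite ffunE inordK // ltnS (bounded_tuples_le i eT).
rewrite [RHS](reindex_onto g f) /=; last first.
  by move=> e eT; apply/ffunP => i; apply: val_inj; rewrite /= gE fE.
apply: eq_big => [e|e _]; last by apply: Gext => i; rewrite gE.
apply/idP/andP => [eT|[]].
  have gT : g e \in bounded_tuples N d J.
    have /bounded_tuplesP[e0 es] := eT; apply/bounded_tuplesP; split.
      by move=> i /e0 ei; apply: val_inj; rewrite /= gE ei.
    by rewrite -[RHS]es; apply: eq_bigr => i _; rewrite gE.
  by split=> //; apply/eqP/ffunP => i; apply: val_inj; rewrite /= fE // gE.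
move=> gT _; have /bounded_tuplesP[e0 es] := gT; apply/bounded_tuplesP; split.
  by move=> i /e0 /(congr1 val) /=; rewrite gE => ei; apply: val_inj.
by rewrite -[RHS]es; apply: eq_bigr => i _; rewrite gE.
Qed.

(** The terms with [e i = 0] vanish, and every other tuple is a tuple of sum [d] plus the unit
    vector at [i]. *)
Lemma sum_bounded_tuples_succ (d : nat) J (i : 'I_n) (G : ('I_n -> nat) -> K) :
  i \in J -> (forall e e', e =1 e' -> G e = G e') ->
  (forall e, e i = 0%N -> G e = 0) ->
  \sum_(e in bounded_tuples d.+1 d.+1 J) G (fun k => e k)
  = \sum_(e in bounded_tuples d.+1 d J) G (fun k => e k + (k == i))%N.
Proof.
move=> iJ Gext G0.
pose f (e : {ffun 'I_n -> 'I_d.+2}) : {ffun 'I_n -> 'I_d.+2} :=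
  [ffun k => inord (e k + (k == i))].
pose g (e : {ffun 'I_n -> 'I_d.+2}) : {ffun 'I_n -> 'I_d.+2} :=
  [ffun k => inord (e k - (k == i))].
have gE e k : g e k = (e k - (k == i))%N :> nat.
  by rewrite ffunE inordK // ltnS (leq_trans (leq_subr _ _)) // -ltnS.
have fE e k : e \in bounded_tuples d.+1 d J ->
    f e k = (e k + (k == i))%N :> nat.
  move=> eT; rewrite ffunE inordK // ltnS -[X in (_ <= X)%N]addn1.
  by rewrite leq_add ?(bounded_tuples_le k eT) // leq_b1.
have sum1 : (\sum_(k in J) (k == i) = 1)%N.
  by rewrite (bigD1 i) //= eqxx big1 ?addn0 // => k /andP[_ /negbTE->].
rewrite (bigID (fun e : {ffun 'I_n -> 'I_d.+2} => e i == ord0)) /=.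
rewrite big1 ?add0r; last by move=> e /andP[_ /eqP ei]; rewrite G0 // ei.
rewrite (reindex_onto f g) /=; last first.
  move=> e /andP[eT ei]; apply/ffunP => k; apply: val_inj.
  rewrite /= ffunE gE subnK ?inord_val //.
  by case: eqP => // ->; rewrite lt0n.
apply: eq_big => [e|e /andP[/andP[_ fi] /eqP ge]]; last first.
  apply: Gext => k; rewrite -{2}ge gE subnK //.
  by case: eqP => // ->; rewrite lt0n.
apply/idP/idP => [/andP[/andP[fT fi] /eqP ge]|eT].
  (* The value e i = d.+1, for which inord overflows, is excluded by fi. *)
  have fE' k : f e k = (e k + (k == i))%N :> nat.
    rewrite -{2}ge gE subnK //.
    by case: eqP => // ->; rewrite lt0n.
  have /bounded_tuplesP[f0 fs] := fT; apply/bounded_tuplesP; split.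
    move=> k kJ; have /(congr1 val) := f0 k kJ; rewrite /= fE' => /eqP.
    by rewrite addn_eq0 => /andP[/eqP ek _]; apply: val_inj.
  apply/eqP; rewrite -(eqn_add2r 1) -{1}sum1 -big_split /=; apply/eqP.
  rewrite [RHS]addn1 -[RHS]fs.
  by apply: eq_bigr => k _; rewrite fE'.
have /bounded_tuplesP[e0 es] := eT; apply/andP; split; last first.
  by apply/eqP/ffunP => k; apply: val_inj; rewrite /= gE fE // addnK.
rewrite -(inj_eq val_inj) /= fE // eqxx addn1 /= andbT.
apply/bounded_tuplesP; split.
  move=> k kJ; apply: val_inj; rewrite /= fE // e0 //= add0n.
  by case: eqP kJ => // ->; rewrite iJ.
rewrite -[RHS]addn1 -[X in (X + 1)%N]es -[X in (_ + X)%N]sum1 -big_split /=.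
by apply: eq_bigr => k _; apply: fE.
Qed.

(** * Shifts of the variables and the recursion for [A_sum] *)

Definition shift (i : 'I_n) (c : K) x : {ffun 'I_n -> K} :=
  [ffun k => if k == i then c * x k else x k].

(** For [i] in [J], this is [1 - q] times the summand of [A_1] at the unit vector [i]. *)
Definition coef J m x (i : 'I_n) : K :=
  x i ^ m / ((\prod_(k in J | k != i) (1 - x k / x i))
             * \prod_(j in ~: J) (1 - q * (x i / x j))).

Hypothesis q_not_root : forall k, q ^+ k.+1 != 1.

Lemma generic_shift i x : generic x -> generic (shift i q x).
Proof.
move=> [x_neq0 x_sep]; split=> [k|k l a b kl]; rewrite !ffunE.
  by case: ifP => // _; rewrite mulf_neq0.
have move c z : q ^+ c * (q * z) = q ^+ c.+1 * z by rewrite mulrA -exprSr.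
by case: ifP; case: ifP; rewrite ?move => _ _; apply: x_sep.
Qed.

Lemma generic_shiftV i x : generic x -> generic (shift i q^-1 x).
Proof.
move=> [x_neq0 x_sep]; split=> [k|k l a b kl]; rewrite !ffunE.
  by case: ifP => // _; rewrite mulf_neq0 ?invr_eq0.
rewrite -(inj_eq (mulfI q_neq0)) !mulrA -!exprS.
have move c z : q ^+ c.+1 * (q^-1 * z) = q ^+ c * z.
  by rewrite exprSr mulrA mulfK.
by case: ifP; case: ifP; rewrite ?move => _ _; apply: x_sep.
Qed.

Lemma generic_ratio x i k a :
  generic x -> (0 < a)%N || (k != i) -> 1 - q ^+ a * x k / x i != 0.
Proof.
move=> [x_neq0 x_sep] aki; rewrite subr_eq0 eq_sym.
rewrite -(inj_eq (mulIf (x_neq0 i))) divfK // mul1r.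
have [ki|ki] := eqVneq k i; last by have := x_sep k i a 0%N ki; rewrite mul1r.
move: aki; rewrite ki eqxx orbF; case: a => // a _.
by rewrite -[X in _ != X]mul1r (inj_eq (mulIf (x_neq0 i))).
Qed.

(** Of the points [q^t x_i] with [t <= e i], the one with [t = 0] is split off; the rest are the
    points [q^t (q x_i)] with [t < e i]. The end points agree, so every remaining factor is
    unchanged. *)
Lemma box_prod_shift J m x (e : 'I_n -> nat) i :
  i \in J ->
  box_prod J m x (fun k => e k + (k == i))%N
  = box J m x (fun k => e k + (k == i))%N (x i) * box_prod J m (shift i q x) e.
Proof.
move=> iJ; set e' := fun k => _.
have boxE b : box J m (shift i q x) e b = box J m x e' b.
  congr (_ / (_ * _)); apply: eq_bigr => k kJ; rewrite ffunE.
    rewrite /e'; case: eqP => _; last by rewrite addn0.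
    by rewrite addn1 exprSr !mulrA.
  by case: eqP kJ => // ->; rewrite inE iJ.
rewrite /box_prod (bigD1 i) //= [X in _ = _ * X](bigD1 i) //=.
have -> : e' i = (e i).+1 by rewrite /e' eqxx addn1.
rewrite big_ord_recl mul1r mulrA; congr (_ * _ * _).
  apply: eq_bigr => t _; rewrite boxE ffunE eqxx.
  by rewrite mulrA -exprSr.
apply: eq_bigr => k /andP[_ /negPf ki]; rewrite /e' ki addn0.
by apply: eq_bigr => t _; rewrite boxE ffunE ki.
Qed.

(** The numerator cancels the only part of [box] at [x i] that depends on [e]. Positivity of [e i]
    makes its factor [1 - q^(e i)] nonzero. *)
Lemma box_coef J m x (e : 'I_n -> nat) i :
  generic x -> i \in J -> (0 < e i)%N ->
  (\prod_(k in J) (1 - q ^+ e k * x k / x i))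
    / \prod_(k in J | k != i) (1 - x k / x i) * box J m x e (x i)
  = coef J m x i.
Proof.
move=> gx iJ ei; rewrite /box /coef.
set P := \prod_(k in J) _; have P_neq0 : P != 0.
  apply/prodf_neq0 => k _; apply: generic_ratio => //.
  by have [->|_] := eqVneq k i; rewrite ?ei ?orbT.
by rewrite !invfM -[RHS]mulr1 -(mulVf P_neq0); ring.
Qed.

Lemma A_sumE d x J m :
  A_sum d x q J m
  = \sum_(e in bounded_tuples d d J) box_prod J m x (fun i => e i).
Proof. by apply: eq_bigr => e _; rewrite summand_box_prod. Qed.

Lemma A_sum_rec d x J m : generic x ->
  (1 - q ^+ d.+1) * A_sum d.+1 x q J m
  = \sum_(i in J) coef J m x i * A_sum d (shift i q x) q J m.
Proof.
move=> gx; have [x_neq0 x_sep] := gx.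
pose L (i : 'I_n) (e : 'I_n -> nat) :=
  (\prod_(k in J) (1 - q ^+ e k * x k / x i))
  / \prod_(k in J | k != i) (1 - x k / x i).
have eqL i e e' : e =1 e' -> L i e = L i e'.
  by move=> ee'; congr (_ / _); apply: eq_bigr => k _; rewrite ee'.
rewrite A_sumE big_distrr /=.
(* As the entries of [e] sum to [d.+1], the factor [1 - q^(d+1)] is one minus the product of the
   [q^(e k)], which [lagrange_sum_ratio] with [c k = q^(e k)] expands as the sum of the [L i e]. *)
transitivity (\sum_(e in bounded_tuples d.+1 d.+1 J) \sum_(i in J)
   L i (fun k => e k) * box_prod J m x (fun k => e k)).
  apply: eq_bigr => e /bounded_tuplesP[_ es].
  rewrite -big_distrl /=; congr (_ * _).
  rewrite lagrange_sum_ratio //; first by rewrite prodrXr es.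
  move=> i k _ _ xik; apply/eqP; apply: contraT => ik.
  by have := x_sep i k 0%N 0%N ik; rewrite xik eqxx.
rewrite exchange_big /=; apply: eq_bigr => i iJ.
rewrite (@sum_bounded_tuples_succ _ _ i (fun e => L i e * box_prod J m x e)) //.
- rewrite A_sumE.
  rewrite (@sum_bounded_tuples_widen d.+1 d J (box_prod J m (shift i q x))) //.
    rewrite big_distrr /=; apply: eq_bigr => e _.
    rewrite box_prod_shift // mulrA.
    rewrite -(@box_coef J m x (fun k => e k + (k == i))%N i) //.
    by rewrite eqxx addn1.
  by move=> e e'; apply: eq_box_prod.
- by move=> e e' ee'; rewrite (eqL _ _ _ ee') (eq_box_prod _ _ _ ee').
(* When [e i = 0], the factor [k = i] of the numerator is [1 - x_i / x_i = 0]. *)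
- move=> e ei; rewrite /L (bigD1 i) //= ei mul1r divff ?subrr ?mul0r //.
Qed.

(** * Inversion of the variables, which carries [A_sum] to [B_sum] *)

Definition invx x : {ffun 'I_n -> K} := [ffun i => (x i)^-1].

Lemma generic_invx x : generic x -> generic (invx x).
Proof.
move=> [x_neq0 x_sep]; split=> [i|i j a b ij]; rewrite !ffunE ?invr_eq0 //.
apply: contraNneq (x_sep i j b a ij) => xij.
by apply/eqP; rewrite -[q ^+ b](divfK (x_neq0 j)) -xij mulrAC divfK.
Qed.

Lemma shift_invx i x : shift i q (invx x) = invx (shift i q^-1 x).
Proof. by apply/ffunP => k; rewrite !ffunE; case: ifP => _ //;
  rewrite invfM invrK. Qed.

(** Since [e(e+1)/2 = e(e-1)/2 + e], each summand gains [q] to the sum of the entries, which is the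
    constant [q^d]. *)
Lemma B_sum_invx d x J m :
  B_sum d x q J m = (q ^+ d) ^ m * A_sum d (invx x) q J m.
Proof.
rewrite /A_sum big_distrr; apply: eq_bigr => e /bounded_tuplesP[_ es] /=.
rewrite mulrA; congr (_ / (_ * _)).
- rewrite -expfzMl; congr (_ ^ m).
  rewrite -[X in q ^+ X]es -prodrXr -big_split /=; apply: eq_bigr => i _.
  have -> : ((e i * (e i).+1)./2 = (e i * (e i).-1)./2 + e i)%N.
    by rewrite -bin2 mulnC -[(_ * _)./2]/((e i).+1 * (e i).+1.-1)./2 -bin2 binS
      bin1.
  by rewrite exprD ffunE exprVn; ring.
- apply: eq_bigr => i _; apply: eq_bigr => j _.
  by rewrite !ffunE invrK [x j / _]mulrC.
apply: eq_bigr => i _; apply: eq_bigr => j _.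
by rewrite !ffunE invrK [x j / _]mulrC.
Qed.

Lemma shift_invxV i x : shift i q^-1 (invx x) = invx (shift i q x).
Proof. by apply/ffunP => k; rewrite !ffunE; case: ifP => _ //;
  rewrite invfM. Qed.

(** * The two shift operators and their commutation *)

Definition raise J m (f : {ffun 'I_n -> K} -> K) x : K :=
  \sum_(i in J) coef J m x i * f (shift i q x).

(** The factor [q ^ m] is the quotient of the prefactors of [B_sum_invx] at [d.+1] and at [d]. *)
Definition lower J m (f : {ffun 'I_n -> K} -> K) x : K :=
  \sum_(j in J) q ^ m * coef J m (invx x) j * f (shift j q^-1 x).

Lemma B_sum_rec d x J m : generic x ->
  (1 - q ^+ d.+1) * B_sum d.+1 x q J m
  = lower J m (fun y => B_sum d y q J m) x.
Proof.
move=> gx; rewrite B_sum_invx mulrCA A_sum_rec; last exact: generic_invx.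
rewrite big_distrr; apply: eq_bigr => j _ /=.
by rewrite B_sum_invx shift_invx exprS expfzMl; ring.
Qed.

(** The recursions are known at generic points only, so functions are compared there. *)
Lemma eq_raise J m f g x : (forall y, generic y -> f y = g y) ->
  generic x -> raise J m f x = raise J m g x.
Proof.
by move=> fg gx; apply: eq_bigr => i _; rewrite fg //; apply: generic_shift.
Qed.

Lemma eq_lower J m f g x : (forall y, generic y -> f y = g y) ->
  generic x -> lower J m f x = lower J m g x.
Proof.
by move=> fg gx; apply: eq_bigr => i _; rewrite fg //; apply: generic_shiftV.
Qed.

Lemma raise_scale J m c f x :
  raise J m (fun y => c * f y) x = c * raise J m f x.
Proof. by rewrite big_distrr; apply: eq_bigr => i _ /=; rewrite mulrCA. Qed.

Lemma lower_scale J m c f x :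
  lower J m (fun y => c * f y) x = c * lower J m f x.
Proof. by rewrite big_distrr; apply: eq_bigr => i _ /=; rewrite mulrCA. Qed.

Lemma coefD1 J m x i j : j \in ~: J ->
  coef J m x i
  = x i ^ m / (\prod_(k in J | k != i) (1 - x k / x i))
    / \prod_(k in ~: J | k != j) (1 - q * (x i / x k)) / (1 - q * (x i / x j)).
Proof. by move=> jJ; rewrite /coef [\prod_(k in ~: J) _](bigD1 j) //= !invfM;
  ring. Qed.

(** A shift of [x j] with [j] outside [J] touches one factor only, the one isolated by [coefD1]. *)
Lemma coef_shift J m c x i j : i \in J -> j \in ~: J ->
  coef J m (shift j c x) i
  = x i ^ m / (\prod_(k in J | k != i) (1 - x k / x i))
    / \prod_(k in ~: J | k != j) (1 - q * (x i / x k))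
    / (1 - q * (x i / (c * x j))).
Proof.
move=> iJ jJ; have J_neq_j k : k \in J -> (k == j) = false.
  by move=> kJ; case: eqP jJ => // <-; rewrite inE kJ.
rewrite (coefD1 _ _ _ jJ) !ffunE eqxx J_neq_j //.
congr (_ / _ / _ / _); apply: eq_bigr => k /andP[kJ kn]; rewrite !ffunE.
  by rewrite J_neq_j.
by rewrite (negPf kn).
Qed.

(** For [i] in [J] and [j] outside, the shifts commute, and in either order the factors mixing [i]
    and [j] are the inverses of [1 - q x_i/x_j] and [1 - q^2 x_i/x_j]: whichever operator acts
    second sees the ratio multiplied by [q]. *)
Lemma raise_lowerC J m m' f x :
  raise J m (lower (~: J) m' f) x = lower (~: J) m' (raise J m f) x.
Proof.
rewrite /raise /lower.
under eq_bigr do rewrite big_distrr /=.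
under [RHS]eq_bigr do rewrite big_distrr /=.
rewrite exchange_big /=; apply: eq_bigr => j jJ; apply: eq_bigr => i iJ.
have ij : (i == j) = false by case: eqP iJ jJ => // ->; rewrite inE => ->.
have ji : (j == i) = false by rewrite eq_sym.
rewrite [LHS]mulrA [RHS]mulrA; congr (_ * f _); last first.
  apply/ffunP => k; rewrite !ffunE.
  by case: (eqVneq k j) => [->|_] //; rewrite ji.
have iJC : i \in ~: ~: J by rewrite setCK.
(* The inverted point is itself a shift by [q^-1], so [coef_shift] applies to both coefficients, the
   second time with [J] and its complement exchanged. *)
rewrite -[invx (shift i q x)]shift_invxV !coef_shift //.
rewrite (coefD1 _ _ _ jJ) (coefD1 _ _ _ iJC).
rewrite !ffunE.
have -> : (x j)^-1 / (x i)^-1 = x i / x j by rewrite invrK mulrC.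
have -> : (x j)^-1 / (q^-1 / x i) = x i / (q^-1 * x j).
  by rewrite !invfM !invrK; ring.
ring.
Qed.

(** * The base identity and the induction on [d] *)

(** At the nodes [y], the left terms are [C * y_i^N / D_i] and the right ones [- C * y_j^N / D_j].
    The difference of the two sides is [C] times the interpolation sum of [X^N], which is zero. *)
Lemma coef_balance J (N : nat) x : (N.+1 < n)%N -> generic x ->
  \sum_(i in J) coef J (N%:Z + 1 - #|J|%:Z) x i
  = \sum_(j in ~: J) q ^ (- (N%:Z + 1 - #|J|%:Z))
      * coef (~: J) (- (N%:Z + 1 - #|J|%:Z)) (invx x) j.
Proof.
move=> Nn [x_neq0 x_sep].
pose y i := if i \in J then x i else q^-1 * x i.
have y_neq0 i : y i != 0.
  by rewrite /y; case: ifP => // _; rewrite mulf_neq0 ?invr_eq0.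
have qy i : q * y i = q ^+ (i \in J) * x i.
  by rewrite /y; case: ifP; rewrite ?mulVKf ?mul1r.
have y_inj : injective y.
  move=> i j yij; apply/eqP/contraT => ij.
  by have := x_sep i j (i \in J : nat) (j \in J : nat) ij;
    rewrite -!qy yij eqxx.
set m := _ - _.
pose D i := \prod_(k | k != i) (y i - y k).
(* [C] gathers the denominators of the factors [1 - y_i / y_j = (y_i - y_j) / (- y_j)]. *)
pose C := \prod_(j in ~: J) - y j.
(* This is the coefficient of degree [n - 1] in [X^N], zero because [N < n - 1]. *)
have sum0 : \sum_i y i ^+ N / D i = 0.
  pose s := [seq y k | k <- enum 'I_n].
  have us : uniq s by rewrite map_inj_uniq ?enum_uniq.
  have szs : size s = n by rewrite size_map size_enum_ord.
  have := @lagrange_sum_lead _ s 'X^N us.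
  rewrite size_polyXn szs coefXn => /(_ (ltnW Nn)).
  case: eqP => [E|_]; first by have := leq_trans Nn (leqSpred n);
    rewrite E ltnn.
  move=> coef0; rewrite -[RHS]coef0 big_map big_enum; apply: eq_bigr => i _ /=.
  rewrite hornerXn big_map big_enum_cond; congr (_ / _).
  by apply: eq_bigl => k /=; rewrite (inj_eq y_inj).
have ratioC z (A : pred 'I_n) : z != 0 ->
    \prod_(k | A k) (1 - y k / z) = (\prod_(k | A k) (z - y k)) / z ^+ #|A|.
  move=> z_neq0; rewrite -prodr_const -prodf_div.
  by apply: eq_bigr => k _; rewrite mulrBl divff.
have ratioV z (A : pred 'I_n) :
    \prod_(k | A k) (1 - z / y k)
    = (\prod_(k | A k) (z - y k)) / \prod_(k | A k) - y k.
  rewrite -prodf_div; apply: eq_bigr => k _.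
  by rewrite invrN mulrN -mulNr opprB mulrBl divff.
have DE i : D i = (\prod_(k in J | k != i) (y i - y k))
                * \prod_(k in ~: J | k != i) (y i - y k).
  rewrite /D (bigID (mem J)) /=; congr (_ * _); apply: eq_bigl => k.
    by rewrite andbC.
  by rewrite inE andbC.
have coefJ i : i \in J -> coef J m x i = C * (y i ^+ N / D i).
  move=> iJ.
  have yi : y i = x i by rewrite /y iJ.
  have -> : coef J m x i = y i ^ m / ((\prod_(k in J | k != i) (1 - y k / y i))
             * \prod_(j in ~: J) (1 - y i / y j)).
    rewrite /coef yi; congr (_ / (_ * _)); apply: eq_bigr => k.
      by move=> /andP[kJ _]; rewrite /y kJ.
    rewrite inE => /negPf kJ; rewrite /y kJ invfM invrK; congr (1 - _); ring.
  rewrite ratioC // ratioV DE.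
  have -> : \prod_(k in ~: J | k != i) (y i - y k)
      = \prod_(k in ~: J) (y i - y k).
    apply: eq_bigl => k; rewrite inE.
    by case: (eqVneq k i) => [->|]; rewrite ?iJ ?andbT.
  set A := fun k => (k \in J) && (k != i).
  (* Clearing the denominators [y i] gives one power for each of the [#|J| - 1] other elements of
     [J]. *)
  have yN : y i ^ m * y i ^+ #|A| = y i ^+ N.
    have cJ : #|J| = #|A|.+1.
      by rewrite (cardD1 i) iJ; congr _.+1; apply: eq_card => k;
        rewrite !inE andbC.
    rewrite !exprnP -expfzDr // /m cJ -addn1 PoszD; congr (_ ^ _); ring.
  by rewrite -/C -yN !invfM !invrK; ring.
have coefJC j : j \in ~: J ->
    q ^ (- m) * coef (~: J) (- m) (invx x) j = - C * (y j ^+ N / D j).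
  move=> jJ.
  have yj : y j = q^-1 * x j by move: jJ; rewrite inE /y => /negPf ->.
  have -> : q ^ (- m) * coef (~: J) (- m) (invx x) j
    = y j ^ m / ((\prod_(k in ~: J | k != j) (1 - y j / y k))
             * \prod_(i in J) (1 - y i / y j)).
    rewrite /coef setCK mulrA; congr (_ / (_ * _)).
    - by rewrite ffunE yj expfzMl -!exprz_inv invrK.
    - apply: eq_bigr => k /andP[]; rewrite inE => /negPf kJ _.
      rewrite !ffunE yj /y kJ invfM !invrK; congr (1 - _).
      by rewrite -[LHS]mul1r -(mulVf q_neq0); ring.
    apply: eq_bigr => k kJ; rewrite !ffunE yj /y kJ invfM !invrK.
    by congr (1 - _); ring.
  rewrite ratioC // ratioV DE.
  have -> : \prod_(k in J | k != j) (y j - y k) = \prod_(k in J) (y j - y k).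
    apply: eq_bigl => k; move: jJ; rewrite inE.
    by case: (eqVneq k j) => [->|]; rewrite ?andbT // andbF => /negPf.
  have yN : y j ^ m * y j ^+ #|J| = y j * y j ^+ N.
    by rewrite -exprS !exprnP -expfzDr // /m subrK -addn1 PoszD.
  (* Here all [#|J|] factors contribute a power of [y j], one more than before; the extra [y j]
     completes the product to [C], with the opposite sign. *)
  have -> : - C = y j * \prod_(k in ~: J | k != j) - y k.
    by rewrite /C (bigD1 j) //= mulNr opprK.
  rewrite [RHS]mulrACA -yN.
  by rewrite !invfM !invrK; ring.
rewrite (eq_bigr _ coefJ) (eq_bigr _ coefJC) -!big_distrr /= mulNr.
apply/eqP; rewrite -subr_eq0 opprK -mulrDr.
have -> : \sum_(i in ~: J) y i ^+ N / D i
    = \sum_(i | i \notin J) y i ^+ N / D i.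
  by apply: eq_bigl => i; rewrite inE.
by move: sum0; rewrite (bigID (mem J)) /= => ->; rewrite mulr0.
Qed.

Lemma A_sum0 x J m : A_sum 0 x q J m = 1.
Proof.
rewrite A_sumE (big_pred1 [ffun => ord0]) => [|e].
  by rewrite /box_prod big1 // => k _; rewrite ffunE big_ord0.
apply/bounded_tuplesP/eqP => [_|->].
  by apply/ffunP => i; rewrite (ord1 (e i)) ffunE.
by split=> [i _|]; rewrite ?ffunE // big1 // => i _; rewrite ffunE.
Qed.

Lemma A_sum_eq_B_sum J (N : nat) d x : (N.+1 < n)%N -> generic x ->
  A_sum d x q J (N%:Z + 1 - #|J|%:Z)
  = B_sum d x q (~: J) (- (N%:Z + 1 - #|J|%:Z)).
Proof.
move=> Nn; set m := _ - _.
have q_num_neq0 d' : 1 - q ^+ d'.+1 != 0 by rewrite subr_eq0 eq_sym.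
pose A d' (y : {ffun 'I_n -> K}) := A_sum d' y q J m.
pose B d' (y : {ffun 'I_n -> K}) := B_sum d' y q (~: J) (- m).
pose E := raise J m; pose F := lower (~: J) (- m).
have A_rec d' y : generic y -> (1 - q ^+ d'.+1) * A d'.+1 y = E (A d') y.
  exact: A_sum_rec.
have B_rec d' y : generic y -> (1 - q ^+ d'.+1) * B d'.+1 y = F (B d') y.
  exact: B_sum_rec.
(* The induction carries [E A_d = F B_d] as well. The step for it is [E (E A_d) = E (F B_d) = F (E
   B_d) = F (E A_d) = F (F B_d)], up to the factor [1 - q^(d+1)]. *)
suff AB d' : (forall y, generic y -> A d' y = B d' y)
    /\ (forall y, generic y -> E (A d') y = F (B d') y).
  by move=> gx; apply: (AB d).1.
elim: d' => [|d' [IHAB IHEF]].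
  have A0 y : A 0 y = 1 by apply: A_sum0.
  have B0 y : B 0 y = 1 by rewrite /B B_sum_invx A_sum0 expr0 exp1rz mul1r.
  split=> [y _|y gy]; first by rewrite A0 B0.
  rewrite /E /F /raise /lower.
  under eq_bigr do rewrite A0 mulr1.
  under [RHS]eq_bigr do rewrite B0 mulr1.
  exact: coef_balance.
split=> y gy; apply: (mulfI (q_num_neq0 d')).
  by rewrite A_rec // B_rec // IHEF.
rewrite -raise_scale -lower_scale.
rewrite (@eq_raise _ _ _ (F (B d'))) //; last first.
  by move=> z gz; rewrite A_rec // IHEF.
rewrite (@eq_lower _ _ _ (E (A d'))) //; last first.
  by move=> z gz; rewrite B_rec // IHEF.
rewrite raise_lowerC; apply: eq_lower => // z gz.
by apply: eq_raise => // w gw; rewrite IHAB.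
Qed.

End Recursion.

(** * Passage to the indeterminates *)

(** This replaces the plain function [xvar] by a finite function, the form of point used in the
    recursion. *)
Lemma eq_A_sum (K : fieldType) (n d : nat) (x y : 'I_n -> K) q J m :
  x =1 y -> A_sum d x q J m = A_sum d y q J m.
Proof.
move=> xy; apply: eq_bigr => e _; congr (_ ^ m / (_ * _)).
- by apply: eq_bigr => i _; rewrite xy.
- by apply: eq_bigr => i _; apply: eq_bigr => j _; rewrite !xy.
- by apply: eq_bigr => i _; apply: eq_bigr => j _; rewrite !xy.
Qed.

Lemma eq_B_sum (K : fieldType) (n d : nat) (x y : 'I_n -> K) q J m :
  x =1 y -> B_sum d x q J m = B_sum d y q J m.
Proof.
move=> xy; apply: eq_bigr => e _; congr (_ ^ m / (_ * _)).
- by apply: eq_bigr => i _; rewrite xy.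
- by apply: eq_bigr => i _; apply: eq_bigr => j _; rewrite !xy.
- by apply: eq_bigr => i _; apply: eq_bigr => j _; rewrite !xy.
Qed.

Section Indeterminates.

Variables (F : fieldType) (n : nat).

Lemma mpolyX_inj : injective (fun m : 'X_{1..n} => 'X_[m] : {mpoly F[n]}).
Proof.
move=> m m' /(congr1 (mcoeff m)); rewrite !mcoeffX eqxx.
by case: eqP => [->//|_] /eqP; rewrite oner_eq0.
Qed.

Lemma mpolyX_neq0 (m : 'X_{1..n}) : 'X_[m] != 0 :> {mpoly F[n]}.
Proof.
by apply: contra_neq (oner_neq0 F) => m0;
  rewrite -(mcoeff0 F m) -m0 mcoeffX eqxx.
Qed.

End Indeterminates.

Section RationalFunctions.

Variables (F : fieldType) (n : nat).

Lemma qvar_neq0 : qvar F n != 0.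
Proof. by rewrite tofrac_eq0 mpolyX_neq0. Qed.

Lemma qvar_not_root k : qvar F n ^+ k.+1 != 1.
Proof.
rewrite -tofracXn -tofrac1 tofrac_eq mpolyXn -mpolyX0.
rewrite (inj_eq (@mpolyX_inj F n.+1)).
apply/eqP => /mnmP /(_ ord0).
by rewrite mulmnE mnm1E eqxx mnm0E mul1n.
Qed.

(** Distinct monomials are distinct: the exponent of [x_i] is 1 on one side and 0 on the other. *)
Lemma generic_xvar : generic (qvar F n) [ffun i => @xvar F n i].
Proof.
split=> [i|i j a b ij]; rewrite !ffunE; first by rewrite tofrac_eq0 mpolyX_neq0.
rewrite -!tofracXn -!tofracM tofrac_eq !mpolyXn -!mpolyXD.
rewrite (inj_eq (@mpolyX_inj F n.+1)).
apply/eqP => /mnmP /(_ (lift ord0 i)).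
rewrite !mnmDE !mulmnE !mnm1E eqxx !(inj_eq lift_inj).
by rewrite [j == i]eq_sym (negPf ij).
Qed.

End RationalFunctions.

Theorem proposition1p1 (F : fieldType) (r n d : nat) (l : int)
    (I : {set 'I_n})
    (hr : (0 < r < n)%N) (hd : (0 < d)%N)
    (hI : I \proper [set: 'I_n]) (hIr : #|I| = r)
    (hl : 1 - #|I|%:Z <= l <= n%:Z - #|I|%:Z - 1) :
  A_sum d (@xvar F n) (qvar F n) I l
  = B_sum d (@xvar F n) (qvar F n) (~: I) (- l).
Proof.
have /andP[hl1 hl2] := hl.
(* The exponent is [N = l + |I| - 1]: the lower bound on [l] makes it non-negative, and the upper
   bound gives [N + 1 < n]. *)
have [N lN] : exists N : nat, l = N%:Z + 1 - #|I|%:Z.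
  exists (absz (l + #|I|%:Z - 1)%R); rewrite gez0_abs; first by ring.
  by rewrite subr_ge0 -lerBlDr.
have Nn : (N.+1 < n)%N.
  by move: hl2; rewrite lN [n%:Z - _ - _]addrAC lerD2r lerBrDr -!PoszD lez_nat
    !addn1.
rewrite lN (@eq_A_sum _ _ _ _ [ffun i => @xvar F n i]); last first.
  by move=> i; rewrite ffunE.
rewrite (@eq_B_sum _ _ _ _ [ffun i => @xvar F n i]); last first.
  by move=> i; rewrite ffunE.
apply: A_sum_eq_B_sum => //.
- exact: qvar_neq0.
- exact: qvar_not_root.
- exact: generic_xvar.
Qed.
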